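(* Let $T$ be a $\mu$-invariant Markov kernel on $(E,\mathscr{E})$ and $\Phi$ a sieve for which there exist functions $f$ with $0<\Phi(f)<\infty$. Suppose that $T$ possesses some $(\Phi,\alpha)$-WPI or $(\Phi,\beta)$-WPI (weak Poincaré inequality). Then $\alpha^\star(\cdot;\Phi)$ defines a $(\Phi,\alpha^\star)$-WPI and $\beta^\star(\cdot;\Phi)$ defines a $(\Phi,\beta^\star)$-WPI. Furthermore, the functions $\alpha^\star(\cdot;\Phi):(0,\mathfrak{a}]\to[0,\infty)$ and $\beta^\star(\cdot;\Phi):[0,\infty)\to[0,\mathfrak{a}]$ are convex and continuous. In addition, $\beta^\star$ is strictly decreasing to $0$ and $\alpha^\star=(\beta^\star)^{-1}$ is the inverse function, which is well-defined on $(0,\mathfrak{a}]$ and strictly decreasing.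
   Context: $(E,\mathscr{E})$ is a measurable space, $\mu$ a probability measure on it. $\|\cdot\|_2$ is the norm of $L^2(\mu)$; $L^2_0(\mu)$ is the set of real $f\in L^2(\mu)$ with $\mu(f)=0$; $\mathcal{E}(T,f)=\langle(\mathrm{Id}-T)f,f\rangle$ in $L^2(\mu)$. Sieve: $\Phi:L^2(\mu)\to[0,\infty]$ with $\Phi(cf)=c^2\Phi(f)$ for $c>0$ and $\|f-\mu(f)\|_2^2\le\mathfrak{a}\,\Phi(f-\mu(f))$ for all $f\in L^2(\mu)$, where the constant $\mathfrak{a}:=\sup_{f\in L^2_0(\mu)\setminus\{0\}}\|f\|_2^2/\Phi(f)$ is finite. $(\Phi,\alpha)$-WPI for $T$: $\alpha:(0,\infty)\to[0,\infty)$ is decreasing and $\|f\|_2^2\le\alpha(r)\mathcal{E}(T,f)+r\Phi(f)$ for all $r>0$, $f\in L^2_0(\mu)$. $(\Phi,\beta)$-WPI for $T$: $\beta:(0,\infty)\to[0,\infty)$ is decreasing with $\beta(s)\to0$ as $s\to\infty$, and $\|f\|_2^2\le s\,\mathcal{E}(T,f)+\beta(s)\Phi(f)$ for all $s>0$, $f\in L^2_0(\mu)$. Optimal functions: for $r>0$, $$\alpha^\star(r;\Phi)=\sup\left\{\frac{\|g\|_2^2}{\mathcal{E}(T,g)}\left(1-\frac{r}{\|g\|_2^2}\right):g\in L^2_0(\mu),\Phi(g)=1\right\}\vee0$$ (which is $0$ for $r\ge\mathfrak{a}$), and for $s>0$ (and, by the same formula, for $s=0$) $$\beta^\star(s;\Phi)=\sup\left\{\|g\|_2^2-s\,\mathcal{E}(T,g):g\in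 L^2_0(\mu),\Phi(g)=1\right\}\vee0 .$$
   Formalization: ''β* strictly decreasing to 0'' is proved as strictly decreasing while positive, with limit 0 (for T(x,·)=μ, Φ=‖·‖², β*(s)=max(1−s,0), so strictness on all of [0,∞) fails); in the β-WPI the product β(s)Φ(f) is read as ∞ when Φ(f)=∞, even if β(s)=0. *)

(* Defs.v *)
(* Library: MathComp and MathComp-Analysis. *)
From HB Require Import structures.
From mathcomp Require Import all_boot all_order all_algebra.
From mathcomp Require Import all_classical all_reals all_analysis.

Set Implicit Arguments.
Unset Strict Implicit.
Unset Printing Implicit Defensive.
Import Order.TTheory GRing.Theory Num.Theory.
Import numFieldNormedType.Exports.

Local Open Scope classical_set_scope.
Local Open Scope ring_scope.

(* Square-integrable measurable functions, not their a.e. classes: functionals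
   on L^2(mu) are required below to be compatible with a.e. equality. *)
Notation L2 mu := (LfunType mu (lee1n 2)).

Section L2.
Context (d : measure_display) (E : measurableType d) (R : realType).
Variable mu : probability E R.

Definition normsq (f : L2 mu) : R := fine ('N[mu]_2%:E[EFin \o f]) ^+ 2.

Definition inner (f g : E -> R) : R := \int[mu]_x (f x * g x).

Definition mean (f : E -> R) : R := \int[mu]_x f x.

Definition constL2 (c : R) : L2 mu := Lfun_Sub (lee1n 2) (Lfun_cst mu c 2).

Definition center (f : L2 mu) : L2 mu := f - constL2 (mean f).

Definition L20 : set (L2 mu) := [set f : L2 mu | mean f = 0].

Definition invariant_kernel (T : R.-pker E ~> E) : Prop :=
  forall A : set E, measurable A -> (\int[mu]_x T x A = mu A)%E.

(* When mu is T-invariant and f is in L^2(mu), f is (T x)-integrable for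
   mu-almost every x; the value at the other points is irrelevant. *)
Definition kernel_op (T : R.-pker E ~> E) (f : E -> R) : E -> R :=
  fun x => \int[T x]_y f y.

Definition dirichlet (T : R.-pker E ~> E) (f : L2 mu) : R :=
  inner (fun x => f x - kernel_op T f x) f.

(* [maxe _ 0] makes this a supremum in [0, +oo], also when L^2_0(mu) = {0}.
   In the quotient, 1 / 0 = +oo and 1 / +oo = 0. *)
Definition sieve_const (Phi : L2 mu -> \bar R) : \bar R :=
  maxe (ereal_sup [set (normsq f)%:E / Phi f | f in
    L20 `&` [set f : L2 mu | ~ {ae mu, forall x, f x = 0%R}]])%E 0%E.

(* In the last clause and in [beta_WPI], a product with Phi f = +oo stands for
   +oo even if the other factor is 0 (whereas 0 * +oo = 0 in \bar R), so that
   the inequality is void there. *)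
Definition sieve (Phi : L2 mu -> \bar R) : Prop :=
  [/\ (forall f g : L2 mu, {ae mu, forall x, f x = g x} -> Phi f = Phi g),
      (forall f, (0 <= Phi f)%E),
      (forall (c : R) f, 0 < c -> Phi (c *: f) = ((c ^+ 2)%:E * Phi f)%E),
      (sieve_const Phi < +oo)%E &
      (forall f, (Phi (center f) < +oo)%E ->
        ((normsq (center f))%:E <= sieve_const Phi * Phi (center f))%E)].

Definition alpha_WPI (T : R.-pker E ~> E) (Phi : L2 mu -> \bar R)
    (alpha : R -> R) : Prop :=
  [/\ (forall r : R, 0 < r -> 0 <= alpha r),
      {in `]0, +oo[ &, nonincreasing_fun alpha} &
      (forall (r : R) f, 0 < r -> L20 f ->
        ((normsq f)%:E <= (alpha r * dirichlet T f)%:E + r%:E * Phi f)%E)].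

Definition beta_WPI (T : R.-pker E ~> E) (Phi : L2 mu -> \bar R)
    (beta : R -> R) : Prop :=
  [/\ (forall s : R, 0 < s -> 0 <= beta s),
      {in `]0, +oo[ &, nonincreasing_fun beta},
      beta s @[s --> +oo] --> 0 &
      (forall (s : R) f, 0 < s -> L20 f -> (Phi f < +oo)%E ->
        ((normsq f)%:E <= (s * dirichlet T f)%:E + (beta s)%:E * Phi f)%E)].

Definition alpha_star (T : R.-pker E ~> E) (Phi : L2 mu -> \bar R) (r : R) :
    \bar R :=
  maxe (ereal_sup [set (normsq g)%:E / (dirichlet T g)%:E
                         * (1 - r%:E / (normsq g)%:E) | g in
    L20 `&` [set g : L2 mu | Phi g = 1]])%E 0%E.

Definition beta_star (T : R.-pker E ~> E) (Phi : L2 mu -> \bar R) (s : R) :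
    \bar R :=
  maxe (ereal_sup [set (normsq g - s * dirichlet T g)%:E | g in
    L20 `&` [set g : L2 mu | Phi g = 1%E]]) 0%E.

End L2.

(* Strict decrease is required as long as 0 has not been reached: if T has a
   spectral gap, beta_star vanishes on a half-line (e.g. for T x = mu and
   Phi f = ||f||^2, it is s |-> max(1 - s, 0)). *)
Definition strictly_decreasing_to0 (R : realType) (b : R -> R) : Prop :=
  (forall s t : R, 0 <= s -> s < t -> 0 < b s -> b t < b s) /\
  b s @[s --> +oo] --> 0.

(* Main.v *)
(* Write n = ||g||^2 and e = E(T,g) for g in L^2_0(mu) with Phi(g) = 1. Then
   beta* is the upper envelope of the lines s |-> n - s e, and alpha* that of the
   lines r |-> (n - r) / e, so both are convex; moreover alpha*(r) <= s and
   beta*(s) <= r are the same condition "n <= s e + r for all g", which makes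
   them generalized inverses of each other. Since T is a contraction of L^2(mu),
   e <= 2 n <= 2 a, hence beta* is Lipschitz, also at s = 0. A weak Poincare
   inequality bounds e from below where n >= r0 > 0, hence alpha* is locally
   Lipschitz on (0, +oo), and beta* tends to 0. Being convex, beta* is then
   strictly decreasing as long as it is positive, and with continuity this turns
   the generalized inverses into genuine ones. *)
Require Import Defs.
From HB Require Import structures.
From mathcomp Require Import all_boot all_order all_algebra.
From mathcomp Require Import all_classical all_reals all_analysis.
From mathcomp Require Import measurable_realfun ring lra.
Import Order.TTheory GRing.Theory Num.Theory.
Import numFieldNormedType.Exports.
Local Open Scope classical_set_scope.
Local Open Scope ring_scope.

Set Implicit Arguments.
Unset Strict Implicit.
Unset Printing Implicit Defensive.

(** * The Markov kernel as a contraction of L^2(mu), and bounds on its Dirichlet form *)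

Lemma invariant_kernel_integral (d : measure_display) (E : measurableType d)
    (R : realType) (mu : probability E R) (T : R.-pker E ~> E) (f : E -> \bar R) :
  invariant_kernel mu T -> (forall x, (0 <= f x)%E) -> measurable_fun [set: E] f ->
  (\int[mu]_x \int[T x]_y f y = \int[mu]_x f x)%E.
Proof.
move=> invT f0 mf.
(* [mu] is viewed as a kernel from a one-point space, so that the iterated integral becomes an
   integral against a kernel composition, which invariance identifies with [mu]. *)
pose l := kprobability
  (measurable_cst (mu : pprobability E R) : measurable_fun [set: unit] _).
have := @integral_kcomp _ _ _ unit E E R l (kernel.kernel_snd T) tt f f0 mf.
move=> /= <-; apply: eq_measure_integral => A mA _.
exact: invT.
Qed.

Lemma measurable_kernel_op (d : measure_display) (E : measurableType d)
    (R : realType) (T : R.-pker E ~> E) (f : E -> R) :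
  measurable_fun [set: E] f -> measurable_fun setT (kernel_op T f).
Proof.
move=> mf; rewrite /kernel_op /Rintegral.
apply: measurableT_comp => //.
under eq_fun do rewrite integralE.
apply: emeasurable_funB; apply: measurable_fun_integral_kernel.
- by move=> U; exact: measurable_kernel.
- by [].
- by apply: measurable_funepos; apply/measurable_EFinP.
- by move=> U; exact: measurable_kernel.
- by [].
- by apply: measurable_funeneg; apply/measurable_EFinP.
Qed.

(** Jensen's inequality for the square: nothing is to be proved if the right side is infinite;
    otherwise the square is compared with its tangent at the mean. *)
Lemma sqr_Rintegral_le (d : measure_display) (E : measurableType d)
    (R : realType) (P : {measure set E -> \bar R}) (f : E -> R) :
  P setT = 1%E -> measurable_fun [set: E] f ->
  (((\int[P]_x f x) ^+ 2)%:E <= \int[P]_x (f x ^+ 2)%:E)%E.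
Proof.
move=> P1 mf.
have [f2oo|f2oo] := leP +oo%E (\int[P]_x (f x ^+ 2)%:E)%E.
  by rewrite (le_trans _ f2oo)// leey.
have if2 : P.-integrable setT (EFin \o (fun x => f x ^+ 2)).
  apply/integrableP; split; first exact/measurable_EFinP/measurable_funX.
  by under eq_integral do rewrite /= ger0_norm ?sqr_ge0//.
have i1 c : P.-integrable setT (EFin \o cst (c : R)).
  apply/integrableP; split; first exact/measurable_EFinP/measurable_cst.
  rewrite [ltLHS](_ : _ = (\int[P]_x cst (`|c|%:E) x)%E)//.
  by rewrite integral_cst// P1 mule1 ltry.
(* Since [P] is finite, the domination [|f| <= f^2 + 1] makes [f] integrable. *)
have if1 : P.-integrable setT (EFin \o f).
  apply: (le_integrable measurableT _ _ (integrableD measurableT if2 (i1 1))).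
    exact/measurable_EFinP.
  move=> x _ /=.
  rewrite lee_fin [leRHS]ger0_norm ?addr_ge0 ?sqr_ge0// ler_norml.
  by apply/andP; split; nra.
set m := \int[P]_x f x.
have imf : P.-integrable setT (EFin \o (fun x => 2 * m * f x)).
  exact: (integrableZl measurableT (2 * m) if1).
(* f^2 >= 2 m f - m^2 *)
have : \int[P]_x (2 * m * f x - m ^+ 2) <= \int[P]_x (f x ^+ 2).
  apply: le_Rintegral => //.
    exact: (integrableB measurableT imf (i1 (m ^+ 2))).
  move=> x _; have := sqr_ge0 (f x - m).
  by rewrite sqrrB; lra.
rewrite (RintegralB measurableT imf (i1 _)) RintegralZl// -/m.
have -> : \int[P]_x cst (m ^+ 2) x = m ^+ 2.
  by rewrite (Rintegral_cst P measurableT) P1 mulr1.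
rewrite -[X in (_ <= X)%E]fineK; last exact: (integrable_fin_num measurableT if2).
rewrite lee_fin /Rintegral; apply: le_trans.
lra.
Qed.

Section L2_kernel.
Context (d : measure_display) (E : measurableType d) (R : realType).
Variables (mu : probability E R) (T : R.-pker E ~> E).
Hypothesis invT : invariant_kernel mu T.
Implicit Types f : L2 mu.

Lemma normsqE f : normsq f = \int[mu]_x (f x ^+ 2).
Proof.
have Nfin : ('N[mu]_2%:E[EFin \o f])%E \is a fin_num.
  by rewrite ge0_fin_numE ?Lnorm_ge0//; exact: Lfunction_finite.
rewrite /normsq -powR_mulrn ?fine_ge0 ?Lnorm_ge0//.
transitivity (fine ('N[mu]_2%:E[EFin \o f] `^ 2)); first by rewrite -(fineK Nfin).
rewrite poweR_Lnorm//; congr fine; apply: eq_integral => x _.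
by rewrite /= powR_mulrn// real_normK ?num_real.
Qed.

Lemma integrable_sqr f : mu.-integrable setT (EFin \o (fun x => f x ^+ 2)).
Proof. exact/Lfun2_integrable_sqr/LfunP. Qed.

(** Jensen under each [T x], then invariance. The inequality is between extended reals because
    square-integrability of [kernel_op T f] is deduced from it. *)
Lemma integral_sqr_kernel_op_le f :
  (\int[mu]_x (kernel_op T f x ^+ 2)%:E <= \int[mu]_x (f x ^+ 2)%:E)%E.
Proof.
have mf : measurable_fun setT f by exact: measurable_funP.
have mf2 : measurable_fun setT (fun x => (f x ^+ 2)%:E).
  exact/measurable_EFinP/measurable_funX.
rewrite -(invariant_kernel_integral invT _ mf2); last first.
  by move=> x; rewrite lee_fin sqr_ge0.
apply: ge0_le_integral => //.
- by move=> x _; rewrite lee_fin sqr_ge0.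
- exact/measurable_EFinP/measurable_funX/measurable_kernel_op.
- apply: measurable_fun_integral_kernel => //.
    by move=> U; exact: measurable_kernel.
  by move=> x; rewrite lee_fin sqr_ge0.
- by move=> x _; exact: (sqr_Rintegral_le (prob_kernel x) mf).
Qed.

Lemma integrable_sqr_kernel_op f :
  mu.-integrable setT (EFin \o (fun x => kernel_op T f x ^+ 2)).
Proof.
apply/integrableP; split.
  apply/measurable_EFinP/measurable_funX/measurable_kernel_op.
  exact: measurable_funP.
under eq_integral do rewrite /= ger0_norm ?sqr_ge0//.
apply: (le_lt_trans (integral_sqr_kernel_op_le f)).
rewrite -ge0_fin_numE; last first.
  by apply: integral_ge0 => x _; rewrite lee_fin sqr_ge0.
exact: (integrable_fin_num measurableT (integrable_sqr f)).
Qed.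

Lemma kernel_op_contract f :
  \int[mu]_x (kernel_op T f x ^+ 2) <= normsq f.
Proof.
rewrite normsqE; apply: fine_le.
- exact: (integrable_fin_num measurableT (integrable_sqr_kernel_op f)).
- exact: (integrable_fin_num measurableT (integrable_sqr f)).
- exact: integral_sqr_kernel_op_le.
Qed.

Lemma integrable_kernel_op_mul f :
  mu.-integrable setT (EFin \o (fun x => kernel_op T f x * f x)).
Proof.
have mf : measurable_fun setT f by exact: measurable_funP.
apply: (le_integrable measurableT _ _
  (integrableD measurableT (integrable_sqr_kernel_op f) (integrable_sqr f))).
  by apply/measurable_EFinP/measurable_funM => //; exact: measurable_kernel_op.
move=> x _ /=; rewrite lee_fin [leRHS]ger0_norm ?addr_ge0 ?sqr_ge0// ler_norml.
by apply/andP; split; nra.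
Qed.

Lemma dirichletE f :
  dirichlet T f = normsq f - \int[mu]_x (kernel_op T f x * f x).
Proof.
rewrite /dirichlet /inner normsqE.
rewrite -(RintegralB measurableT (integrable_sqr f) (integrable_kernel_op_mul f)).
by congr fine; apply: eq_integral => x _; rewrite mulrBl -expr2.
Qed.

(** By contraction, |<Tf,f>| <= (||Tf||^2 + ||f||^2) / 2 <= ||f||^2, while E(T,f) = ||f||^2 -
    <Tf,f>. *)
Lemma dirichlet_ge0_le2 f : 0 <= dirichlet T f <= 2 * normsq f.
Proof.
have i1 := integrable_sqr_kernel_op f.
have i2 := integrable_sqr f.
have i3 := integrable_kernel_op_mul f.
have i12 : mu.-integrable setT
    (EFin \o (fun x => 2^-1 * (kernel_op T f x ^+ 2 + f x ^+ 2))).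
  exact: (integrableZl measurableT 2^-1 (integrableD measurableT i1 i2)).
have : `|\int[mu]_x (kernel_op T f x * f x)| <=
    \int[mu]_x (2^-1 * (kernel_op T f x ^+ 2 + f x ^+ 2)).
  apply: (le_trans (le_normr_Rintegral measurableT i3)).
  apply: le_Rintegral => //.
    by have /integrable_abse := i3.
  move=> x _ /=; rewrite ler_norml.
  have := sqr_ge0 (kernel_op T f x + f x); have := sqr_ge0 (kernel_op T f x - f x).
  by rewrite sqrrB sqrrD => ? ?; apply/andP; split; lra.
rewrite RintegralZl//; last exact: (integrableD measurableT i1 i2).
rewrite RintegralD// -normsqE dirichletE ler_norml => /andP[h1 h2].
have h3 := kernel_op_contract f.
by apply/andP; split; lra.
Qed.

End L2_kernel.

(** * Upper envelopes of lines: convexity, continuity, inversion *)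

Lemma lipschitz_at_continuous (R : realType) (f : R -> R) (x delta L : R) :
  0 < delta ->
  (forall y, `|x - y| < delta -> `|f x - f y| <= L * `|x - y|) ->
  {for x, continuous f}.
Proof.
move=> d0 fL; apply/cvgrPdist_le => /= eps eps0.
have L0 : 0 < `|L| + 1 by rewrite ltr_pwDr.
near=> y.
have xy : `|x - y| < delta.
  by near: y; apply: cvgr_dist_lt.
have xy' : `|x - y| <= eps / (`|L| + 1).
  by near: y; apply: cvgr_dist_le => //; rewrite divr_gt0.
apply: (le_trans (fL _ xy)).
move: xy'; rewrite ler_pdivlMr//; apply: le_trans.
rewrite mulrC ler_wpM2l// (le_trans (ler_norm _))// lerDl//.
Unshelve. all: by end_near. Qed.

(* alpha and beta are characterized by their upper bounds, so that the results
   apply to real parts of suprema taken in \bar R. *)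
Section line_envelopes.
Context (R : realType) (I : Type) (G : set I) (n e : I -> R) (a : R)
  (alpha beta : R -> R).
Hypothesis e_gt0 : forall g, G g -> 0 < e g.
Hypothesis e_le2 : forall g, G g -> e g <= 2 * n g.
Hypothesis n_le : forall g, G g -> n g <= a.
Hypothesis a_ge0 : 0 <= a.
(** Here and below only nonnegative bounds are tested, because the suprema are truncated at 0; this
    also covers an empty [G]. *)
Hypothesis a_lub : forall M : R, 0 <= M -> (forall g, G g -> n g <= M) -> a <= M.
Hypothesis alpha_ge0 : forall r : R, 0 < r -> 0 <= alpha r.
Hypothesis alpha_le : forall r s : R, 0 < r -> 0 <= s ->
  alpha r <= s <-> forall g, G g -> n g - r <= s * e g.
Hypothesis beta_ge0 : forall s : R, 0 <= beta s.
Hypothesis beta_le : forall s r : R, 0 <= r ->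
  beta s <= r <-> forall g, G g -> n g - s * e g <= r.

Lemma alpha_env_ub r g : 0 < r -> G g -> n g - r <= alpha r * e g.
Proof. by move=> r0; apply: (alpha_le r0 (alpha_ge0 r0)).1. Qed.

Lemma beta_env_ub s g : G g -> n g - s * e g <= beta s.
Proof. exact: (beta_le s (beta_ge0 s)).1. Qed.

(* Both sides mean n g <= s * e g + r for all g. *)
Lemma alpha_beta_env_le r s : 0 < r -> 0 <= s -> alpha r <= s <-> beta s <= r.
Proof.
move=> r0 s0; split.
  move/(alpha_le r0 s0) => h; apply/(beta_le s (ltW r0)) => g Gg.
  by have := h g Gg; lra.
move/(beta_le s (ltW r0)) => h; apply/(alpha_le r0 s0) => g Gg.
by have := h g Gg; lra.
Qed.

Lemma beta_env0 : beta 0 = a.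
Proof.
apply/le_anti/andP; split.
  by apply/(beta_le 0 a_ge0) => g Gg; rewrite mul0r subr0 n_le.
apply: (a_lub (beta_ge0 0)) => g Gg.
by have := beta_env_ub 0 Gg; rewrite mul0r subr0.
Qed.

Lemma beta_env_nincr s t : s <= t -> beta t <= beta s.
Proof.
move=> st; apply/(beta_le t (beta_ge0 s)) => g Gg.
have := beta_env_ub s Gg; have := e_gt0 Gg; nra.
Qed.

Lemma beta_env_le_top s : 0 <= s -> beta s <= a.
Proof. by move=> s0; rewrite -beta_env0 beta_env_nincr. Qed.

Lemma alpha_env_nincr r r' : 0 < r -> r <= r' -> alpha r' <= alpha r.
Proof.
move=> r0 rr'; have r'0 := lt_le_trans r0 rr'.
apply/(alpha_le r'0 (alpha_ge0 r0)) => g Gg; have := alpha_env_ub r0 Gg; lra.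
Qed.

Lemma beta_env_convex s t (p q : R) : 0 <= p -> 0 <= q -> p + q = 1 ->
  beta (p * s + q * t) <= p * beta s + q * beta t.
Proof.
move=> p0 q0 pq.
apply/beta_le => [|g Gg]; first by rewrite addr_ge0 ?mulr_ge0.
(* Each line is affine and the weights sum to 1; [q] is replaced by [- p + 1] to make this a ring
   identity. *)
have -> : n g - (p * s + q * t) * e g =
    p * (n g - s * e g) + q * (n g - t * e g) by rewrite -[q](addKr p) pq; ring.
by rewrite lerD// ler_wpM2l// beta_env_ub.
Qed.

Lemma alpha_env_convex r r' (p q : R) : 0 < r -> 0 < r' -> 0 <= p -> 0 <= q ->
  p + q = 1 -> alpha (p * r + q * r') <= p * alpha r + q * alpha r'.
Proof.
move=> r0 r'0 p0 q0 pq.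
have c0 : 0 < p * r + q * r'.
  have [p00|pn0] := eqVneq p 0.
    by rewrite p00 add0r in pq; rewrite p00 pq mul0r mul1r add0r.
  by rewrite ltr_pwDl ?mulr_ge0 ?(ltW r'0)// mulr_gt0// lt_def pn0.
apply/alpha_le => [//||g Gg]; first by rewrite addr_ge0 ?mulr_ge0 ?alpha_ge0.
have -> : n g - (p * r + q * r') = p * (n g - r) + q * (n g - r')
  by rewrite -[q](addKr p) pq; ring.
rewrite mulrDl -!mulrA.
by rewrite lerD// ler_wpM2l// alpha_env_ub.
Qed.

Lemma beta_env_lipschitz s t : `|beta s - beta t| <= 2 * a * `|s - t|.
Proof.
suff h x y : beta x <= beta y + 2 * a * `|x - y|.
  by have := h s t; have := h t s; rewrite distrC ler_norml; lra.
apply/beta_le => [|g Gg]; first by rewrite addr_ge0 ?mulr_ge0.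
have -> : n g - x * e g = (n g - y * e g) + (y - x) * e g by ring.
rewrite lerD ?beta_env_ub// (@le_trans _ _ (`|x - y| * e g))//.
  by rewrite distrC ler_wpM2r ?ler_norm// ltW// e_gt0.
by rewrite mulrC ler_wpM2r// (le_trans (e_le2 Gg))// ler_wpM2l// n_le.
Qed.

Lemma beta_env_continuous : continuous beta.
Proof.
by move=> x; apply: (@lipschitz_at_continuous _ _ _ 1 (2 * a)) => // y _;
  exact: beta_env_lipschitz.
Qed.

(** Lines r |-> (n - r) / e with [n g < r0] are negative from [r0] on, hence invisible in the
    truncated supremum. The others satisfy [1 <= L * e g], so their slopes are at most [L] in
    absolute value. *)
Lemma alpha_env_lipschitz r0 r r' : 0 < r0 -> r0 <= r -> r0 <= r' ->
  `|alpha r - alpha r'| <= 2 * alpha (r0 / 2) / r0 * `|r - r'|.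
Proof.
move=> r00 rr0 r'r0.
have r02 : 0 < r0 / 2 by rewrite divr_gt0.
set L := 2 * alpha (r0 / 2) / r0.
have L0 : 0 <= L by rewrite divr_ge0 ?mulr_ge0 ?alpha_ge0// ltW.
suff h x y : r0 <= x -> r0 <= y -> alpha x <= alpha y + L * `|x - y|.
  have := h _ _ rr0 r'r0; have := h _ _ r'r0 rr0.
  by rewrite distrC ler_norml; lra.
move=> xr0 yr0; have x0 := lt_le_trans r00 xr0; have y0 := lt_le_trans r00 yr0.
have M0 : 0 <= alpha y + L * `|x - y|.
  by apply: addr_ge0; [exact: alpha_ge0|exact: mulr_ge0].
apply/(alpha_le x0 M0) => g Gg.
have [nr0|nr0] := ltP (n g) r0.
  have nx : n g - x <= 0 by lra.
  by rewrite (le_trans nx)// mulr_ge0// ltW// e_gt0.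
(* alpha (r0 / 2) * e g >= n g - r0 / 2 >= r0 / 2 *)
have Le1 : 1 <= L * e g.
  rewrite /L mulrAC ler_pdivlMr// mul1r.
  by have := alpha_env_ub r02 Gg; lra.
have -> : n g - x = (n g - y) + (y - x) by ring.
rewrite mulrDl lerD ?alpha_env_ub// (le_trans (ler_norm _))// distrC mulrAC.
by rewrite ler_peMl.
Qed.

Lemma alpha_env_continuous r : 0 < r -> {for r, continuous alpha}.
Proof.
move=> r0; have r02 : 0 < r / 2 by rewrite divr_gt0.
(* The points within [r / 2] of [r] stay above [r / 2], which serves as [r0] in the Lipschitz
   estimate. *)
apply: (@lipschitz_at_continuous _ _ _ (r / 2) (2 * alpha (r / 2 / 2) / (r / 2))) => // y.
rewrite ltr_norml => /andP[h1 h2].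
by apply: alpha_env_lipschitz => //; lra.
Qed.

(** The order relation between the envelopes gives [beta (alpha eps) <= eps], and [beta] is
    nonincreasing. *)
Lemma beta_env_cvg0 : beta s @[s --> +oo] --> 0.
Proof.
apply/cvgrPdist_le => eps eps0.
near=> s; rewrite sub0r normrN ger0_norm//.
apply: (@le_trans _ _ (beta (alpha eps))).
  by apply: beta_env_nincr; near: s; apply: nbhs_pinfty_ge; exact: num_real.
by apply/(alpha_beta_env_le eps0 (alpha_ge0 eps0)).
Unshelve. all: by end_near. Qed.

(* A convex function tending to 0 cannot be stationary at a positive level. *)
Lemma beta_env_decr s t : 0 <= s -> s < t -> 0 < beta s -> beta t < beta s.
Proof.
move=> s0 st Bs0; have Bs20 : 0 < beta s / 2 by rewrite divr_gt0.
(* A point beyond [t] where [beta] is at most half of [beta s]. Then [t] is a convex combination of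
   [s] and [u] with positive weight [q] on [u]. *)
pose u := Num.max (t + 1) (alpha (beta s / 2)).
have tu : t < u by rewrite lt_max ltrDl ltr01.
have Bu : beta u <= beta s / 2.
  apply/(alpha_beta_env_le Bs20); first by rewrite (le_trans s0)// ltW// (lt_trans st).
  by rewrite le_max lexx orbT.
have us0 : 0 < u - s by rewrite subr_gt0 (lt_trans st).
pose q := (t - s) / (u - s).
have q0 : 0 < q by rewrite divr_gt0// subr_gt0.
have q1 : q <= 1 by rewrite ler_pdivrMr// mul1r lerD2r ltW.
have -> : t = (1 - q) * s + q * u.
  have : q * (u - s) = t - s by rewrite divfK// gt_eqF.
  lra.
apply: (le_lt_trans (@beta_env_convex s u (1 - q) q _ (ltW q0) _)); [lra|lra|].
nra.
Qed.

(** One inequality in each direction is the order relation. If [alpha r = s] but [beta s < r], then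
    by continuity [beta] is still at most [r] somewhat to the left of [s], which forces
    [alpha r < s]; the case [s = 0] is excluded by [r <= a = beta 0]. If [beta s = r] but
    [alpha r < s], strict decrease gives [beta s < beta (alpha r) <= r]. *)
Lemma alpha_beta_env_inverse r s : 0 < r <= a -> 0 <= s -> alpha r = s <-> beta s = r.
Proof.
move=> /andP[r0 ra] s0; split => [Ars|Bsr].
  have Bs : beta s <= r by apply/(alpha_beta_env_le r0 s0); rewrite Ars.
  apply/le_anti; rewrite Bs /= leNgt; apply/negP => Bsr.
  have a0 : 0 < a by exact: lt_le_trans ra.
  have [s00|sn0] := eqVneq s 0; first by move: Bsr; rewrite s00 beta_env0 ltNge ra.
  (* As [2 * a] is a Lipschitz constant of [beta], moving left by this amount raises [beta] by at
     most [r - beta s]. *)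
  pose s' := Num.max 0 (s - (r - beta s) / (2 * a)).
  have s'0 : 0 <= s' by rewrite le_max lexx.
  have s's : s' < s.
    by rewrite gt_max lt_def sn0 s0 ltrBlDr ltrDl divr_gt0 ?subr_gt0 ?mulr_gt0.
  have : alpha r <= s'.
    apply/(alpha_beta_env_le r0 s'0).
    have := beta_env_lipschitz s' s; rewrite ler_norml => /andP[_].
    rewrite distrC gtr0_norm ?subr_gt0//.
    have : s - (r - beta s) / (2 * a) <= s' by rewrite le_max lexx orbT.
    rewrite lerBlDr -lerBlDl ler_pdivlMr ?mulr_gt0//.
    lra.
  by rewrite Ars leNgt s's.
have Ars : alpha r <= s by apply/(alpha_beta_env_le r0 s0); rewrite Bsr.
apply/le_anti; rewrite Ars /= leNgt; apply/negP => As.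
have BA : beta (alpha r) <= r by apply/(alpha_beta_env_le r0 (alpha_ge0 r0)).
(* Strict decrease requires [0 < beta (alpha r)], which follows from
   [beta (alpha r) >= beta s = r > 0]. *)
have := beta_env_decr (alpha_ge0 r0) As.
have := beta_env_nincr (ltW As); lra.
Qed.

(** [alpha] is nonincreasing, and injective on (0, a] because [beta] inverts it there. *)
Lemma alpha_env_decr r r' : 0 < r -> r < r' -> r' <= a -> alpha r' < alpha r.
Proof.
move=> r0 rr' r'a; have r'0 := lt_trans r0 rr'.
rewrite lt_neqAle alpha_env_nincr ?(ltW rr')// andbT; apply/eqP => Arr'.
have ra : 0 < r <= a by rewrite r0 (le_trans (ltW rr')).
have r'a' : 0 < r' <= a by rewrite r'0.
have Br := (alpha_beta_env_inverse ra (alpha_ge0 r0)).1 erefl.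
have Br' := (alpha_beta_env_inverse r'a' (alpha_ge0 r0)).1 Arr'.
by move: rr'; rewrite -{1}Br -Br' ltxx.
Qed.

End line_envelopes.

(* If f is not integrable, then fine sends the integrals of f and of c * f to
   the same value 0, whence no integrability hypothesis. *)
Lemma RintegralZl_gt0 (d : measure_display) (E : measurableType d)
    (R : realType) (m : {measure set E -> \bar R}) (f : E -> R) (c : R) :
  0 < c -> measurable_fun [set: E] f ->
  \int[m]_x (c * f x) = c * \int[m]_x f x.
Proof.
move=> c0 mf; rewrite /Rintegral.
under eq_integral do rewrite EFinM.
rewrite [in LHS]integralE [in RHS]integralE.
rewrite (_ : (fun x => (c%:E * (f x)%:E)%E) = (fun x => (c%:E * (EFin \o f) x)%E))//.
rewrite ge0_funeposM ?(ltW c0)// ge0_funenegM ?(ltW c0)//.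
rewrite !ge0_integralZl_EFin ?(ltW c0)//;
  [|exact/measurable_funeneg/measurable_EFinP|exact/measurable_funepos/measurable_EFinP].
have := @integral_ge0 _ _ _ m setT (EFin \o f)^\+%E (fun x _ => funepos_ge0 _ x).
have := @integral_ge0 _ _ _ m setT (EFin \o f)^\-%E (fun x _ => funeneg_ge0 _ x).
case: (integral _ _ _) => [u| |]//; case: (integral _ _ _) => [v| |]// _ _.
- by rewrite /= mulrBr.
- by rewrite gt0_muley ?lte_fin//= mulr0.
- by rewrite gt0_muley ?lte_fin//= mulr0.
- by rewrite gt0_muley ?lte_fin//= mulr0.
Qed.

(** * Homogeneity of the norm, the mean and the Dirichlet form *)

Section L2_scale.
Context (d : measure_display) (E : measurableType d) (R : realType).
Variables (mu : probability E R) (T : R.-pker E ~> E).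
Hypothesis invT : invariant_kernel mu T.
Implicit Types f : L2 mu.

Lemma normsqZ f c : normsq (c *: f) = c ^+ 2 * normsq f.
Proof.
rewrite !normsqE -(RintegralZl (c ^+ 2) measurableT (integrable_sqr f)).
by congr fine; apply: eq_integral => x _; rewrite -exprMn.
Qed.

Lemma meanZ f c : 0 < c -> mean mu (c *: f) = c * mean mu f.
Proof. by move=> c0; apply: RintegralZl_gt0 => //; exact: measurable_funP. Qed.

Lemma dirichletZ f c : 0 < c ->
  dirichlet T (c *: f) = c ^+ 2 * dirichlet T f.
Proof.
move=> c0; rewrite !(dirichletE invT) normsqZ mulrBr; congr (_ - _).
rewrite -(RintegralZl (c ^+ 2) measurableT (integrable_kernel_op_mul invT f)).
congr fine; apply: eq_integral => x _.
(* This holds at every [x], also where [f] is not integrable under [T x], so no null set has to be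
   discarded. *)
have -> : kernel_op T (c *: f) x = c * kernel_op T f x.
  by apply: RintegralZl_gt0 => //; exact: measurable_funP.
by have -> : (c *: f) x = c * f x by []; congr EFin; ring.
Qed.

Lemma normsq_eq0 f : normsq f = 0 <-> {ae mu, forall x, f x = 0}.
Proof.
have mf2 : measurable_fun [set: E] (EFin \o (fun x => f x ^+ 2)).
  exact: (measurable_int mu (integrable_sqr f)).
have normE : (\int[mu]_x `|(f x ^+ 2)%:E|)%E = (normsq f)%:E.
  rewrite normsqE /Rintegral fineK.
    by apply: eq_integral => x _; rewrite gee0_abs// lee_fin sqr_ge0.
  exact: (integrable_fin_num measurableT (integrable_sqr f)).
have [h1 h2] := ae_eq_integral_abs mu measurableT mf2.
split => [f0|f0].
  have {}/h1 : (\int[mu]_x `|(f x ^+ 2)%:E|)%E = 0%E by rewrite normE f0.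
  apply: filterS => x /= /(_ I) [] /eqP; rewrite sqrf_eq0.
  by move/eqP.
apply: EFin_inj; rewrite -normE; apply: h2.
by apply: filterS f0 => x /= -> _; rewrite expr0n.
Qed.

Lemma normsq_ge0 f : 0 <= normsq f.
Proof. exact: sqr_ge0. Qed.

End L2_scale.

(** * Sieves and reduction to functions with [Phi g = 1] *)

Section sieves.
Context (d : measure_display) (E : measurableType d) (R : realType).
Variables (mu : probability E R) (T : R.-pker E ~> E) (Phi : L2 mu -> \bar R).
Hypothesis invT : invariant_kernel mu T.
Hypothesis sPhi : sieve Phi.
Implicit Types f g : L2 mu.

Definition unit_level : set (L2 mu) := [set g | L20 g /\ Phi g = 1%E].

Lemma sieve_ge0 f : (0 <= Phi f)%E.
Proof. by case: sPhi. Qed.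

Lemma sieve_const_ge0 : (0 <= sieve_const Phi)%E.
Proof. by rewrite le_max lexx orbT. Qed.

Lemma sieve_const_fin : sieve_const Phi \is a fin_num.
Proof. by rewrite ge0_fin_numE ?sieve_const_ge0//; case: sPhi. Qed.

Lemma fine_sieve_const_ge0 : 0 <= fine (sieve_const Phi).
Proof. by rewrite fine_ge0// sieve_const_ge0. Qed.

(** [f] and [2 *: f] agree almost everywhere, so [Phi f = 4 * Phi f]. Hence null functions never lie
    on the unit level. *)
Lemma sieve_ae0 f : {ae mu, forall x, f x = 0} -> Phi f = 0%E \/ Phi f = +oo%E.
Proof.
move=> f0; case: sPhi => Phi_ae _ PhiZ _ _.
have Phi4 : Phi f = (4%:E * Phi f)%E.
  rewrite [in LHS](Phi_ae f (2 *: f)).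
    by rewrite PhiZ// (_ : 2 ^+ 2 = 4)//; ring.
  apply: filterS f0 => x fx0.
  by rewrite [RHS](_ : _ = 2 * f x)// fx0 mulr0.
move: Phi4 (sieve_ge0 f); case: (Phi f) => [u| |]//; last by right.
by rewrite -EFinM => -[u4] _; left; congr EFin; lra.
Qed.

Lemma sieve_const_ub f : L20 f -> ~ {ae mu, forall x, f x = 0} ->
  ((normsq f)%:E / Phi f <= sieve_const Phi)%E.
Proof.
move=> L20f f0; rewrite le_max ereal_sup_ubound//.
by exists f.
Qed.

Lemma normsq_gt0 f : ~ {ae mu, forall x, f x = 0} -> 0 < normsq f.
Proof.
move=> f0; rewrite lt_def normsq_ge0 andbT.
by apply/eqP => /normsq_eq0.
Qed.

(** Otherwise the quotient in [sieve_const] would be [+oo], against finiteness of the constant. *)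
Lemma sieve_eq0 f : L20 f -> Phi f = 0%E -> normsq f = 0.
Proof.
move=> L20f Phif0; have [/normsq_eq0//|f0] := pselect {ae mu, forall x, f x = 0}.
have := sieve_const_ub L20f f0.
rewrite Phif0 inve0 gt0_muley ?lte_fin ?normsq_gt0// leye_eq => /eqP h.
by have := sieve_const_fin; rewrite h.
Qed.

Lemma unit_level_normsq_gt0 g : unit_level g -> 0 < normsq g.
Proof.
move=> [L20g /= Phig]; apply: normsq_gt0 => /sieve_ae0.
by rewrite Phig => -[/eqP|//]; rewrite onee_eq0.
Qed.

Lemma unit_level_normsq_le g : unit_level g -> normsq g <= fine (sieve_const Phi).
Proof.
move=> Gg; have [L20g /= Phig] := Gg.
rewrite -lee_fin (fineK sieve_const_fin).
have := @sieve_const_ub g L20g; rewrite Phig inve1 mule1; apply.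
by move/normsq_eq0 => g0; have := unit_level_normsq_gt0 Gg; rewrite g0 ltxx.
Qed.

(** [f] is divided by the square root of [Phi f]; all three functionals are homogeneous of degree
    2. *)
Lemma sieve_normalize f : L20 f -> (0 < Phi f < +oo)%E ->
  exists2 g, unit_level g & normsq f = fine (Phi f) * normsq g /\
    dirichlet T f = fine (Phi f) * dirichlet T g.
Proof.
move=> L20f /andP[Phif0 Phifoo].
have Pfin : Phi f \is a fin_num by rewrite ge0_fin_numE// ltW.
have p0 : 0 < fine (Phi f) by rewrite fine_gt0// Phif0.
have c0 : 0 < Num.sqrt (fine (Phi f))^-1 by rewrite sqrtr_gt0 invr_gt0.
have c2 : Num.sqrt (fine (Phi f))^-1 ^+ 2 = (fine (Phi f))^-1.
  by rewrite sqr_sqrtr// ltW// invr_gt0.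
have pn0 : fine (Phi f) != 0 by rewrite gt_eqF.
exists (Num.sqrt (fine (Phi f))^-1 *: f); last first.
  by rewrite normsqZ (dirichletZ invT)// c2 !mulrA mulfV// !mul1r.
split; first by rewrite /L20/= meanZ// L20f mulr0.
case: sPhi => _ _ PhiZ _ _.
by rewrite /= PhiZ// c2 -{2}(fineK Pfin) -EFinM mulVf.
Qed.

(** The quotient is invariant under scaling, so the unit level gives all its values with
    [0 < Phi f < +oo]. The value [Phi f = 0] cannot occur for [f] not null, and [Phi f = +oo]
    contributes 0, whence [0 <= M]. *)
Lemma sieve_const_lub (M : R) : 0 <= M ->
  (forall g, unit_level g -> normsq g <= M) -> fine (sieve_const Phi) <= M.
Proof.
move=> M0 GM; rewrite -lee_fin (fineK sieve_const_fin) ge_max lee_fin M0 andbT.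
apply: ge_ereal_sup => _ [f [L20f /= f0] <-].
have [Phif0|Phifn0] := eqVneq (Phi f) 0%E.
  by have := normsq_gt0 f0; rewrite sieve_eq0// ltxx.
have [->|Phify] := eqVneq (Phi f) +oo%E; first by rewrite invey mule0 lee_fin.
have Phif : (0 < Phi f < +oo)%E.
  by rewrite lt_def Phifn0 sieve_ge0 ltey.
have [g Gg [nE _]] := sieve_normalize L20f Phif.
rewrite nE.
have p0 : 0 < fine (Phi f) by rewrite fine_gt0.
have PhifE : Phi f = (fine (Phi f))%:E.
  by rewrite fineK// ge0_fin_numE ?sieve_ge0// ltey.
rewrite [X in (_ / X)%E]PhifE.
by rewrite inver gt_eqF// -EFinM lee_fin mulrAC mulfV ?gt_eqF// mul1r GM.
Qed.

End sieves.

(** * The optimal functions as envelopes over the unit level *)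

Section optimal_functions.
Context (d : measure_display) (E : measurableType d) (R : realType).
Variables (mu : probability E R) (T : R.-pker E ~> E) (Phi : L2 mu -> \bar R).
Hypothesis invT : invariant_kernel mu T.
Hypothesis sPhi : sieve Phi.

Local Notation G := (unit_level Phi).

(** Common consequence of both kinds of weak Poincaré inequality on normalized functions; it makes
    [alpha_star] finite. *)
Definition weak_poincare : Prop := forall r : R, 0 < r ->
  exists2 s : R, 0 <= s & forall g, G g -> normsq g - r <= s * dirichlet T g.

Lemma alpha_WPI_weak_poincare alpha :
  alpha_WPI T Phi alpha -> weak_poincare.
Proof.
move=> [alpha_ge0 _ wpi] r r0; exists (alpha r); first exact: alpha_ge0.
move=> g [L20g Phig]; have := wpi r g r0 L20g.
by rewrite Phig mule1 -EFinD lee_fin lerBlDr.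
Qed.

Lemma beta_WPI_weak_poincare beta :
  beta_WPI T Phi beta -> weak_poincare.
Proof.
move=> [beta_ge0 _ beta0 wpi] r r0.
near (pinfty_nbhs R) => s.
have s0 : 0 < s by near: s; apply: nbhs_pinfty_gt; exact: num_real.
have br : beta s <= r by near: s; exact: (cvgr_le 0 beta0).
exists s; first exact: ltW.
move=> g [L20g Phig]; have := wpi s g s0 L20g.
rewrite Phig ltry => /(_ isT).
by rewrite mule1 -EFinD lee_fin; lra.
Unshelve. all: by end_near. Qed.

Hypothesis wp : weak_poincare.

(** If E(T,g) = 0, the inequality at r = ||g||^2 / 2 would give ||g||^2 / 2 <= 0. *)
Lemma unit_level_dirichlet_gt0 g : G g -> 0 < dirichlet T g.
Proof.
move=> Gg; have n0 := unit_level_normsq_gt0 sPhi Gg.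
have n20 : 0 < normsq g / 2 by rewrite divr_gt0.
have [s s0 /(_ g Gg)] := wp n20.
have /andP[] := dirichlet_ge0_le2 invT g.
rewrite le_eqVlt => /orP[/eqP <-|//].
by rewrite mulr0; lra.
Qed.

Lemma alpha_star_leP (r s : R) : 0 <= s ->
  (alpha_star T Phi r <= s%:E)%E <->
  forall g, G g -> normsq g - r <= s * dirichlet T g.
Proof.
move=> s0.
(* Both denominators are positive, so the extended-real term is an ordinary quotient. *)
have termE g : G g -> ((normsq g)%:E / (dirichlet T g)%:E *
    (1 - r%:E / (normsq g)%:E))%E = ((normsq g - r) / dirichlet T g)%:E.
  move=> Gg; have e0 := unit_level_dirichlet_gt0 Gg.
  have n0 := unit_level_normsq_gt0 sPhi Gg.
  rewrite !inver !gt_eqF// -!EFinM; congr EFin.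
  by field; rewrite !gt_eqF.
rewrite /alpha_star ge_max lee_fin s0 andbT; split => [h g Gg|h].
  have e0 := unit_level_dirichlet_gt0 Gg.
  rewrite -ler_pdivrMr// -lee_fin -termE//.
  apply: le_trans h; apply: ereal_sup_ubound; exists g => //.
apply: ge_ereal_sup => _ [g Gg <-].
by rewrite termE// lee_fin ler_pdivrMr ?unit_level_dirichlet_gt0// h.
Qed.

Lemma beta_star_leP (s r : R) : 0 <= r ->
  (beta_star T Phi s <= r%:E)%E <->
  forall g, G g -> normsq g - s * dirichlet T g <= r.
Proof.
move=> r0; rewrite /beta_star ge_max lee_fin r0 andbT; split => [h g Gg|h].
  by rewrite -lee_fin; apply: le_trans h; apply: ereal_sup_ubound; exists g.
by apply: ge_ereal_sup => _ [g Gg <-]; rewrite lee_fin h.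
Qed.

Lemma alpha_star_ge0 (r : R) : (0 <= alpha_star T Phi r)%E.
Proof. by rewrite le_max lexx orbT. Qed.

Lemma beta_star_ge0 (s : R) : (0 <= beta_star T Phi s)%E.
Proof. by rewrite le_max lexx orbT. Qed.

Lemma alpha_star_lty (r : R) : 0 < r -> (alpha_star T Phi r < +oo)%E.
Proof.
move=> r0; have [s s0 /(alpha_star_leP r s0) rs] := wp r0.
by rewrite (le_lt_trans rs)// ltry.
Qed.

Lemma beta_star_lty (s : R) : (beta_star T Phi s < +oo)%E.
Proof.
have a0 := fine_sieve_const_ge0 Phi.
set a := fine (sieve_const Phi) in a0.
(* The absolute value covers negative [s], since the envelope hypotheses on [beta] range over all
   real [s]. *)
have M0 : 0 <= a + `|s| * (2 * a) by rewrite addr_ge0// !mulr_ge0.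
apply: (@le_lt_trans _ _ (a + `|s| * (2 * a))%:E); last exact: ltry.
apply/(beta_star_leP s M0) => g Gg.
have na : normsq g <= a := unit_level_normsq_le sPhi Gg.
have /andP[e0 e2] := dirichlet_ge0_le2 invT g.
rewrite lerD// -mulNr (@le_trans _ _ (`|s| * dirichlet T g))//.
  by rewrite ler_wpM2r// -normrN ler_norm.
by rewrite ler_wpM2l//; lra.
Qed.

Local Notation astar r := (fine (alpha_star T Phi r)).
Local Notation bstar s := (fine (beta_star T Phi s)).

Lemma astar_ge0 r : 0 <= astar r.
Proof. by rewrite fine_ge0// alpha_star_ge0. Qed.

Lemma bstar_ge0 s : 0 <= bstar s.
Proof. by rewrite fine_ge0// beta_star_ge0. Qed.

Lemma astar_le r s : 0 < r -> 0 <= s ->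
  astar r <= s <-> forall g, G g -> normsq g - r <= s * dirichlet T g.
Proof.
move=> r0 s0; rewrite -(alpha_star_leP r s0) -lee_fin fineK//.
by rewrite ge0_fin_numE ?alpha_star_ge0 ?alpha_star_lty.
Qed.

Lemma bstar_le s r : 0 <= r ->
  bstar s <= r <-> forall g, G g -> normsq g - s * dirichlet T g <= r.
Proof.
move=> r0; rewrite -(beta_star_leP s r0) -lee_fin fineK//.
by rewrite ge0_fin_numE ?beta_star_ge0 ?beta_star_lty.
Qed.

(** Both weak Poincaré inequalities are homogeneous of degree 2, so they extend from the unit level
    by scaling; if [Phi f = 0], the left side vanishes. *)
Lemma sieve_homogeneous_inequality (s r : R) f : L20 f -> 0 <= s ->
  (Phi f < +oo)%E ->
  (forall g, G g -> normsq g <= s * dirichlet T g + r) ->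
  ((normsq f)%:E <= (s * dirichlet T f)%:E + r%:E * Phi f)%E.
Proof.
move=> L20f s0 Phify h.
have [Phif0|Phifn0] := eqVneq (Phi f) 0%E.
  rewrite Phif0 mule0 adde0 lee_fin (sieve_eq0 sPhi)//.
  by rewrite mulr_ge0//; case/andP: (dirichlet_ge0_le2 invT f).
have Phif : (0 < Phi f < +oo)%E by rewrite lt_def Phifn0 (sieve_ge0 sPhi).
have [g Gg [nE eE]] := sieve_normalize invT sPhi L20f Phif.
have PhifE : Phi f = (fine (Phi f))%:E.
  by rewrite fineK// ge0_fin_numE ?(sieve_ge0 sPhi).
have p0 : 0 <= fine (Phi f) by rewrite fine_ge0// (sieve_ge0 sPhi).
rewrite nE eE [X in (_ * X)%E]PhifE -EFinM -EFinD lee_fin.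
by have := ler_wpM2l p0 (h g Gg); lra.
Qed.

End optimal_functions.

Theorem theorem21 (d : measure_display) (E : measurableType d) (R : realType)
    (mu : probability E R) (T : R.-pker E ~> E) (Phi : L2 mu -> \bar R) :
  invariant_kernel mu T ->
  sieve Phi ->
  (exists f : L2 mu, (0 < Phi f < +oo)%E) ->
  (exists alpha : R -> R, alpha_WPI T Phi alpha) \/
  (exists beta : R -> R, beta_WPI T Phi beta) ->
  let a : R := fine (sieve_const Phi) in
  let astar : R -> R := fun r => fine (alpha_star T Phi r) in
  let bstar : R -> R := fun s => fine (beta_star T Phi s) in
  (forall r : R, 0 < r -> (0 <= alpha_star T Phi r < +oo)%E) /\
  alpha_WPI T Phi astar /\
  (forall s : R, 0 <= s -> (0 <= beta_star T Phi s <= sieve_const Phi)%E) /\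
  beta_WPI T Phi bstar /\
  convex_function (`]0, a]%classic : set R) astar /\
  {within `]0, a], continuous astar} /\
  convex_function (`[0, +oo[%classic : set R) bstar /\
  {within `[0, +oo[, continuous bstar} /\
  strictly_decreasing_to0 bstar /\
  (forall r s : R, 0 < r <= a -> 0 <= s -> (astar r = s <-> bstar s = r)) /\
  {in `]0, a] &, {homo astar : r r' /~ r < r'}}.
Proof.
move=> invT sPhi _ wpi a astar bstar.
have wp : weak_poincare T Phi.
  case: wpi => -[]; first exact: alpha_WPI_weak_poincare.
  exact: beta_WPI_weak_poincare.
(* The envelope results are used with [normsq] as [n] and [dirichlet T] as [e]; the following facts
   are their hypotheses. *)
pose G := unit_level Phi.
have a_ge0 : 0 <= a := fine_sieve_const_ge0 Phi.
have e_gt0 g : G g -> 0 < dirichlet T g by exact: unit_level_dirichlet_gt0.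
have e_le2 g : G g -> dirichlet T g <= 2 * normsq g.
  by case/andP: (dirichlet_ge0_le2 invT g).
have n_le g : G g -> normsq g <= a by exact: unit_level_normsq_le.
have a_lub (M : R) : 0 <= M -> (forall g, G g -> normsq g <= M) -> a <= M.
  exact: (sieve_const_lub invT sPhi).
have alpha_ge0 (r : R) : 0 < r -> 0 <= astar r by move=> _; exact: astar_ge0.
have alpha_le (r s : R) : 0 < r -> 0 <= s ->
    astar r <= s <-> forall g, G g -> normsq g - r <= s * dirichlet T g.
  exact: astar_le.
have beta_ge0 (s : R) : 0 <= bstar s := bstar_ge0 T Phi s.
have beta_le (s r : R) : 0 <= r ->
    bstar s <= r <-> forall g, G g -> normsq g - s * dirichlet T g <= r.
  exact: bstar_le.
have aE : a%:E = sieve_const Phi by rewrite fineK// sieve_const_fin.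
have beta_cvg0 : bstar s @[s --> +oo] --> 0 :=
  beta_env_cvg0 e_gt0 alpha_ge0 alpha_le beta_ge0 beta_le.
split; first by move=> r r0; rewrite alpha_star_ge0 alpha_star_lty.
split.
  split=> [//| |r f r0 L20f].
    move=> r r'; rewrite !in_itv/= !andbT => r0 r'0 rr'.
    exact: (alpha_env_nincr alpha_ge0 alpha_le r0 rr').
  have [Phify|] := ltP (Phi f) +oo%E.
    apply: sieve_homogeneous_inequality => //; first exact: alpha_ge0.
    by move=> g Gg; rewrite -lerBlDr; exact: (alpha_env_ub alpha_ge0 alpha_le r0 Gg).
  (* For [Phi f = +oo] the right side is infinite because [r > 0]. *)
  by rewrite leye_eq => /eqP ->; rewrite gt0_muley ?lte_fin// addey ?leey.
split.
  move=> s s0; rewrite beta_star_ge0 -aE.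
  apply/(beta_star_leP T Phi s a_ge0)/beta_le => //.
  exact: (beta_env_le_top e_gt0 n_le a_ge0 a_lub beta_ge0 beta_le s0).
split.
  split=> [//| |//|s f s0 L20f Phify].
    by move=> s s' _ _ ss'; exact: (beta_env_nincr e_gt0 beta_ge0 beta_le ss').
  apply: sieve_homogeneous_inequality => //; first exact: ltW.
  by move=> g Gg; rewrite -lerBlDl; exact: (beta_env_ub beta_ge0 beta_le s Gg).
split.
  move=> t x y; rewrite !inE/= !in_itv/= => /andP[x0 _] /andP[y0 _].
  rewrite !convRE; apply: (alpha_env_convex alpha_ge0 alpha_le) => //.
    exact: unstable.onem_ge0.
  exact: unstable.add_onemK.
split.
  apply: continuous_in_subspaceT => x; rewrite inE/= in_itv/= => /andP[x0 _].
  exact: (alpha_env_continuous e_gt0 alpha_ge0 alpha_le x0).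
split.
  move=> t x y _ _.
  rewrite !convRE; apply: (beta_env_convex beta_ge0 beta_le) => //.
    exact: unstable.onem_ge0.
  exact: unstable.add_onemK.
split.
  apply: continuous_subspaceT.
  exact: (beta_env_continuous e_gt0 e_le2 n_le a_ge0 beta_ge0 beta_le).
split.
  split=> // s t s0 st Bs0.
  exact: (beta_env_decr alpha_le beta_ge0 beta_le s0 st Bs0).
split.
  move=> r s ra s0.
  exact: (alpha_beta_env_inverse e_gt0 e_le2 n_le a_ge0 a_lub
    alpha_ge0 alpha_le beta_ge0 beta_le ra s0).
move=> r r'; rewrite !in_itv/= => /andP[r0 ra] /andP[r'0 r'a] rr'.
by apply: (alpha_env_decr e_gt0 e_le2 n_le a_ge0 a_lub
  alpha_ge0 alpha_le beta_ge0 beta_le).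
Qed.
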